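(* Let $K \subseteq \mathbb{R}^n$ be an origin symmetric convex body and let $R \geq r > 0$ be such that $r \mathbb{B}^n \subseteq K \subseteq R \mathbb{B}^n$. Then the following are equivalent: (i) $d_{BM}(K,\mathbb{B}^n)=\frac{R}{r}$. (ii) For every real symmetric $n\times n$ matrix $A$, there exist an outer contact point $y \in \mathrm{bd}(K) \cap \mathrm{bd}(R \mathbb{B}^n)$ and an inner contact point $z \in \mathrm{bd}(K) \cap \mathrm{bd}(r \mathbb{B}^n)$ such that $\left\langle \frac{y}{R}, A \frac{y}{R} \right\rangle \geq \left\langle \frac{z}{r}, A \frac{z}{r} \right\rangle$. (iii) There exist integers $N, M \geq 1$, outer contact points $y^1, \ldots, y^N \in \mathrm{bd}(K) \cap \mathrm{bd}(R\mathbb{B}^n)$, inner contact points $z^1, \ldots, z^M \in \mathrm{bd}(K) \cap \mathrm{bd}(r\mathbb{B}^n)$, as well as weights $\lambda_1, \ldots, \lambda_N, \mu_1, \ldots, \mu_M > 0$, such that for any $x \in \mathbb{R}^n$ we have $$ \sum_{i=1}^N \lambda_i \langle x, y^i \rangle y^i = \sum_{i=1}^M \mu_i \langle x, z^i \rangle z^i. $$ In this case, $R^2 \sum_{i=1}^N \lambda_i = r^2 \sum_{i=1}^M \mu_i$ (for the weights of such a decomposition), and there exists a choice of the decomposition in (iii) with $N+M \leq \frac{n(n+1)}{2} + 1$.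
   Context: A convex body in $\mathbb{R}^n$ is a compact convex set with non-empty interior; it is origin symmetric if $K=-K$. $\langle\cdot,\cdot\rangle$ is the standard inner product, $\mathbb{B}^n$ the closed Euclidean unit ball of $\mathbb{R}^n$, and $\mathrm{bd}$ denotes the boundary. The Banach-Mazur distance of convex bodies $K,L\subseteq\mathbb{R}^n$ is $d_{BM}(K,L)=\inf\{\rho>0 : K+u\subseteq T(L+v)\subseteq\rho(K+u)\}$, where the infimum is over all invertible linear operators $T:\mathbb{R}^n\to\mathbb{R}^n$ and vectors $u,v\in\mathbb{R}^n$ (it is attained, and for origin symmetric $K,L$ one may take $u=v=0$). *)

(* Defs.v *)
From HB Require Import structures.
From mathcomp Require Import all_boot all_order all_algebra.
From mathcomp Require Import all_classical all_reals all_analysis.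

Set Implicit Arguments.
Unset Strict Implicit.
Unset Printing Implicit Defensive.

Import Order.TTheory GRing.Theory Num.Theory.
Import numFieldNormedType.Exports.

Local Open Scope classical_set_scope.
Local Open Scope ring_scope.

(* R^n is represented by row vectors 'rV[F]_n over F : realType.  The library
   norm `|x| on 'rV[F]_n is the sup norm, hence the explicit Euclidean norm
   below; the topology is the usual one. *)

Definition dotv (F : realType) (n : nat) (x y : 'rV[F]_n) : F :=
  \sum_(i < n) x ord0 i * y ord0 i.

Definition enorm (F : realType) (n : nat) (x : 'rV[F]_n) : F :=
  Num.sqrt (dotv x x).

Definition unit_ball (F : realType) (n : nat) : set 'rV[F]_n :=
  [set x | enorm x <= 1].
Arguments unit_ball : clear implicits.

Definition translate (F : realType) (n : nat) (u : 'rV[F]_n)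
  (A : set 'rV[F]_n) : set 'rV[F]_n := [set x + u | x in A].

Definition dilate (F : realType) (n : nat) (c : F)
  (A : set 'rV[F]_n) : set 'rV[F]_n := [set c *: x | x in A].

Definition bd (T : topologicalType) (A : set T) : set T :=
  closure A `\` interior A.

Definition convex_body (F : realType) (n : nat) (K : set 'rV[F]_n) : Prop :=
  [/\ compact K,
      convex_set (K : set (convex_lmodType 'rV[F]_n)) &
      interior K !=set0].

Definition origin_symmetric (F : realType) (n : nat) (K : set 'rV[F]_n) :
  Prop := [set - x | x in K] = K.

(* For convex bodies the set below is nonempty and it is bounded below by 0, so
   the real-valued [inf] is the true infimum. *)
Definition dBM (F : realType) (n : nat) (K L : set 'rV[F]_n) : F :=
  inf [set rho : F | 0 < rho /\
    exists (T : {linear 'rV[F]_n -> 'rV[F]_n}) (u v : 'rV[F]_n),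
      [/\ bijective T,
          translate u K `<=` T @` translate v L &
          T @` translate v L `<=` dilate rho (translate u K)]].

Definition contact (F : realType) (n : nat) (K : set 'rV[F]_n) (c : F) :
  set 'rV[F]_n := bd K `&` bd (dilate c (unit_ball F n)).

Definition contact_decomposition (F : realType) (n : nat) (K : set 'rV[F]_n)
    (R r : F) (N M : nat) (y : 'I_N -> 'rV[F]_n) (z : 'I_M -> 'rV[F]_n)
    (lambda : 'I_N -> F) (mu : 'I_M -> F) : Prop :=
  [/\ (1 <= N)%N /\ (1 <= M)%N,
      (forall i, contact K R (y i)) /\ (forall j, contact K r (z j)),
      (forall i, 0 < lambda i) /\ (forall j, 0 < mu j) &
      forall x : 'rV[F]_n,
        \sum_(i < N) (lambda i * dotv x (y i)) *: y i =
        \sum_(j < M) (mu j * dotv x (z j)) *: z j].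

(* Main.v *)
Require Import Defs.
From HB Require Import structures.
From mathcomp Require Import all_boot all_order all_algebra.
From mathcomp Require Import all_classical all_reals all_analysis.
From mathcomp Require Import ring lra.

Import Order.TTheory GRing.Theory Num.Theory.
Import numFieldNormedType.Exports.

Local Open Scope classical_set_scope.
Local Open Scope ring_scope.

(** Write B for the Euclidean unit ball.

    Translations may be dropped from the definition of the distance: if
    K + u <= T (B + v) <= rho (K + u), averaging each inclusion with its image
    under x |-> -x and using convexity gives K <= T B <= rho K, for the same
    rho.  With M the inverse of T this reads: |x M| <= 1 on K, and |x M| <= 1
    implies x in rho K ([sandwich]).  Since rB <= K <= RB makes R / r
    admissible, dBM K B = R / r says that no sandwich has ratio below R / r
    ([dBM_eq_ratio]).

    (i) => (ii).  If a quadratic form A violates (ii), subtracting a multiple of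
    |x|^2 from it makes it negative at all outer contact points and positive at
    all inner ones ([separating_form]).  For small e > 0 the form
    f x = |x (1 + e A)|^2 = |x|^2 + 2 e <x, x A> + e^2 |x A|^2 is then below
    R^2 on K and above r^2 on bd K: away from the contact points there is room,
    near them the first-order term has the right sign, and compactness makes e
    uniform.  The sublevel sets of f are ellipsoids that sandwich K with a ratio
    below R / r ([sandwich_perturb]).

    (ii) => (iii).  Consider the compact set S of the matrices y^T y (y an outer
    contact point) and - z^T z (z an inner one).  Either 0 is a convex
    combination of elements of S, and the combination is the decomposition, or
    some linear functional is positive on S, and the corresponding form violates
    (ii) ([gordan_compact]).  Symmetric matrices form a space of dimension
    n (n + 1) / 2, so by Caratheodory n (n + 1) / 2 + 1 elements of S suffice
    ([decomposition_of_forms]).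

    (iii) => (i).  The decomposition says that the matrices
    sum_i lambda_i y_i^T y_i and sum_j mu_j z_j^T z_j agree, hence so do the
    weighted sums of values of every quadratic form ([decomposition_form]).
    For |x|^2 this is R^2 sum lambda = r^2 sum mu.  For the form |x M|^2 of a
    sandwich of ratio rho, the values at the y_i are at most 1 and those at the
    z_j at least rho^-2, so that rho^-2 sum mu <= sum lambda, that is,
    R / r <= rho ([sandwich_lower_bound]). *)

(** * Euclidean inner product *)

Section Euclidean.
Context {F : realType} {n : nat}.
Implicit Types x y : 'rV[F]_n.

Lemma dotvE x y : dotv x y = (x *m y^T) 0 0.
Proof. by rewrite mxE; apply: eq_bigr => i _; rewrite mxE. Qed.

Lemma dotvC x y : dotv x y = dotv y x.
Proof. by apply: eq_bigr => i _; rewrite mulrC. Qed.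

Lemma dotvDl x1 x2 y : dotv (x1 + x2) y = dotv x1 y + dotv x2 y.
Proof. by rewrite !dotvE mulmxDl mxE. Qed.

Lemma dotvZl a x y : dotv (a *: x) y = a * dotv x y.
Proof. by rewrite !dotvE -scalemxAl mxE. Qed.

Lemma dotvDr x y1 y2 : dotv x (y1 + y2) = dotv x y1 + dotv x y2.
Proof. by rewrite dotvC dotvDl !(dotvC x). Qed.

Lemma dotvZr a x y : dotv x (a *: y) = a * dotv x y.
Proof. by rewrite dotvC dotvZl dotvC. Qed.

Lemma dotv_ge0 x : 0 <= dotv x x.
Proof. by apply: sumr_ge0 => i _; rewrite -expr2 sqr_ge0. Qed.

Lemma dotv_eq0 x : (dotv x x == 0) = (x == 0).
Proof.
apply/idP/eqP => [|->]; last by rewrite dotvE mul0mx mxE.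
rewrite psumr_eq0 => [/allP h|i _]; last by rewrite -expr2 sqr_ge0.
apply/rowP => i; rewrite mxE; apply/eqP.
by have := h i (mem_index_enum i); rewrite mulf_eq0 orbb.
Qed.

Lemma enorm_le c x : 0 <= c -> (enorm x <= c) = (dotv x x <= c ^+ 2).
Proof.
move=> c0; rewrite /enorm -(ler_sqr (sqrtr_ge0 _))// ?nnegrE//.
by rewrite sqr_sqrtr// dotv_ge0.
Qed.

Lemma dilate_ball c x : 0 < c ->
  dilate c (unit_ball F n) x <-> dotv x x <= c ^+ 2.
Proof.
move=> c0; split=> [[y]|h].
  rewrite /unit_ball/= enorm_le// expr1n => y1 <-.
  by rewrite dotvZl dotvZr mulrA -expr2 ler_piMr// sqr_ge0.
exists (c^-1 *: x); last by rewrite scalerA divff ?scale1r// gt_eqF.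
rewrite /unit_ball/= enorm_le// expr1n dotvZl dotvZr mulrA -expr2 exprVn.
by rewrite mulrC ler_pdivrMr ?mul1r// exprn_gt0.
Qed.

Lemma dotv_form x (C : 'M[F]_n) : dotv x (x *m C) = \tr (C *m (x^T *m x)).
Proof.
rewrite dotvC dotvE mulmxA (mxtrace_mulC (C *m x^T)) mulmxA.
by rewrite /mxtrace big_ord1.
Qed.

Lemma dotv_mulmx x (M : 'M[F]_n) :
  dotv (x *m M) (x *m M) = dotv x (x *m (M *m M^T)).
Proof. by rewrite !dotvE !trmx_mul trmxK !mulmxA. Qed.

(** Turns the two sides of a contact decomposition, which are functions of x,
    into the action of a single matrix on x. *)
Lemma dotv_scale_dyad a x y : (a * dotv x y) *: y = x *m (a *: (y^T *m y)).
Proof.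
rewrite -scalemxAr mulmxA -scalerA; congr (_ *: _).
by rewrite [x *m y^T]mx11_scalar mul_scalar_mx dotvE.
Qed.

End Euclidean.

(** * Continuity and compactness *)

Section Continuity.
Context {F : realType}.

Lemma continuous_sum {T : topologicalType} {I : Type} (s : seq I)
    (f : I -> T -> F) :
  (forall i, continuous (f i)) -> continuous (fun x => \sum_(i <- s) f i x).
Proof.
move=> fc; apply: continuous_big => [|i _]; first exact: add_continuous.
exact: fc.
Qed.

Lemma continuous_mul {T : topologicalType} (f g : T -> F) :
  continuous f -> continuous g -> continuous (fun x => f x * g x).
Proof. by move=> fc gc x; apply: cvgM; [exact: fc|exact: gc]. Qed.

Lemma continuous_opp {T : topologicalType} (f : T -> F) :
  continuous f -> continuous (fun x => - f x).
Proof. by move=> fc x; apply: cvgN; exact: fc. Qed.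

(** The entries are taken in an arbitrary topological space because tuples of
    vectors occur below as row vectors whose entries are row vectors. *)
Lemma continuous_entry {T : topologicalType} {m p : nat} (i : 'I_m) (j : 'I_p) :
  continuous (fun M : 'M[T]_(m, p) => M i j).
Proof.
move=> M A /= MA.
exists (fun i' j' => [set x | (i', j') = (i, j) -> A x]) => /=.
  move=> i' j'; have [[-> ->]|ne] := eqVneq (i', j') (i, j).
    by apply: (@filterS _ (nbhs (M i j)) _ A) => // y Ay.
  apply: (@filterS _ (nbhs (M i' j')) _ setT); last exact: filterT.
  by move=> x _ /= e; rewrite e eqxx in ne.
by move=> N /= h; exact: h.
Qed.

Lemma continuous_matrix {T U : topologicalType} {m p : nat}
    (f : T -> 'M[U]_(m, p)) :
  (forall i j, continuous (fun x => f x i j)) -> continuous f.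
Proof.
move=> fc x A [P /= xP PA]; apply: (@filterS _ (nbhs x) _
  [set y | forall i j, P i j (f y i j)]).
  by move=> y; exact: PA.
apply: filter_forall => i; apply: filter_forall => j.
exact: (fc i j x).
Qed.

Lemma continuous_scaler n (x : 'rV[F]_n) : continuous (fun t : F => t *: x).
Proof.
apply: continuous_matrix => i j.
have -> : (fun t : F => (t *: x) i j) = fun t => t * x i j.
  by apply/funext => t; rewrite mxE.
by apply: continuous_mul => t; [exact: cvg_id|exact: cvg_cst].
Qed.

Lemma continuous_dotv n (A B : 'M[F]_n) :
  continuous (fun x : 'rV[F]_n => dotv (x *m A) (x *m B)).
Proof.
have h (C : 'M[F]_n) i : continuous (fun x : 'rV[F]_n => (x *m C) ord0 i).
  have -> : (fun x : 'rV[F]_n => (x *m C) ord0 i) =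
      fun x => \sum_j x ord0 j * C j i by apply/funext => x; rewrite mxE.
  apply: continuous_sum => j; apply: continuous_mul => x.
    exact: continuous_entry.
  exact: cst_continuous.
by apply: continuous_sum => i; apply: continuous_mul; exact: h.
Qed.

Lemma continuous_sqnorm n : continuous (fun x : 'rV[F]_n => dotv x x).
Proof.
have -> : (fun x : 'rV[F]_n => dotv x x) =
    fun x => dotv (x *m 1%:M) (x *m 1%:M).
  by apply/funext => x; rewrite mulmx1.
exact: continuous_dotv.
Qed.

(** Used contrapositively: a point whose outward multiples leave A at once is
    not interior to A. *)
Lemma interior_scale_right n (A : set 'rV[F]_n) (x : 'rV[F]_n) (t : F) :
  interior A (t *: x) -> \forall s \near t^'+, A (s *: x).
Proof.
by move=> tx; apply: cvg_within; exact: (@continuous_scaler n x t _ tx).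
Qed.

End Continuity.

Section Perturbation.
Context {F : realType} {T : topologicalType} {A : set T}.
Hypothesis cA : compact A.

(** Stands in for the maximum of f on A, with the advantage that it also makes
    sense when A is empty. *)
Lemma compact_lt_gap (f : T -> F) b c : continuous f -> b < c ->
  (forall x, A x -> f x < c) ->
  exists d, [/\ b < d, d < c & forall x, A x -> f x < d].
Proof.
move=> fc bc fA.
have near_gap : \forall d \near c^'-, forall x, A x -> f x < d.
  apply: ((compact_near_coveringP A).1 cA F c^'- (fun d x => f x < d)) => x Ax.
  pose m := (f x + c) / 2.
  have [fm mc] : f x < m /\ m < c by have := fA x Ax; rewrite /m; split; lra.
  exists ([set y | f y < m], [set d | m < d]) => /=.
    by split; [apply: cvgr_lt fm; exact: fc|exact: nbhs_left_gt].
  by move=> [y d] /= [ym md]; exact: lt_trans ym md.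
have : \forall d \near c^'-, [/\ b < d, d < c & forall x, A x -> f x < d].
  by apply: filterS3 near_gap (nbhs_left_gt bc) (nbhs_left_lt c).
by move/filter_ex.
Qed.

(** First-order perturbation on a compact set.  Near a point with g x = c the
    bracket h + e k stays negative; near a point with g x < c the perturbation
    is absorbed by the room left below c.  Compactness turns these local choices
    of e into a single one. *)
Lemma compact_perturb_lt (g h k : T -> F) c :
  continuous g -> continuous h -> continuous k ->
  (forall x, A x -> g x <= c) -> (forall x, A x -> g x = c -> h x < 0) ->
  \forall e \near 0^'+, forall x, A x -> g x + e * (h x + e * k x) < c.
Proof.
move=> gc hc kc gA hA.
have near_lt : \forall e \near (0 : F)^'+, forall x, A x ->
    A x -> 0 < e -> g x + e * (h x + e * k x) < c.
  apply: ((compact_near_coveringP A).1 cA F (0 : F)^'+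
    (fun e x => A x -> 0 < e -> g x + e * (h x + e * k x) < c)) => x Ax.
  have cvgf (u : T -> F) : continuous u ->
      u p.1 @[p --> filter_prod (nbhs x) (0 : F)^'+] --> u x.
    by move=> uc; apply: (cvg_comp fst u cvg_fst (uc x)).
  have cvge : p.2 @[p --> filter_prod (nbhs x) (0 : F)^'+] --> (0 : F).
    by apply: cvg_trans (@cvg_snd T F _ _ _) _; exact: cvg_within.
  have cvghk : h p.1 + p.2 * k p.1 @[p --> filter_prod (nbhs x) (0 : F)^'+] -->
      h x + 0 * k x.
    by apply: cvgD; [exact: cvgf|apply: cvgM => //; exact: cvgf].
  have [gx|gx] := eqVneq (g x) c.
    have /cvgr_lt := cvghk; rewrite mul0r addr0 => /(_ 0 (hA _ Ax gx)).
    apply: filterS => -[y e] /= hk Ay e0.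
    (* Here the bound g y <= c, valid on A only, is what is needed. *)
    by apply: (lt_le_trans _ (gA _ Ay)); rewrite gtrDl pmulr_rlt0.
  have {}gx : g x < c by rewrite lt_neqAle gx gA.
  have cvgghk : g p.1 + p.2 * (h p.1 + p.2 * k p.1)
      @[p --> filter_prod (nbhs x) (0 : F)^'+] --> g x + 0 * (h x + 0 * k x).
    by apply: cvgD; [exact: cvgf|exact: cvgM].
  have /cvgr_lt := cvgghk; rewrite mul0r addr0 => /(_ c gx).
  by apply: filterS => -[y e] /=.
by apply: filterS2 near_lt (nbhs_right_gt 0) => e h' e0 x Ax; exact: h'.
Qed.

End Perturbation.

(** * Contact points of a body between two balls *)

Section ContactPoints.
Context {F : realType} {n : nat} {K : set 'rV[F]_n} {R r : F}.
Hypotheses (cK : compact K) (hr : 0 < r) (hR : 0 < R).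
Hypotheses (hin : dilate r (unit_ball F n) `<=` K)
           (hout : K `<=` dilate R (unit_ball F n)).
Implicit Types x : 'rV[F]_n.

Lemma open_sqnorm_lt (c : F) : open [set x : 'rV[F]_n | dotv x x < c].
Proof.
apply: (@open_comp _ _ (fun x : 'rV[F]_n => dotv x x) [set t | t < c]).
  by move=> x _; exact: continuous_sqnorm.
exact: open_lt.
Qed.

Lemma bd_ball (c : F) x : 0 < c ->
  bd (dilate c (unit_ball F n)) x <-> dotv x x = c ^+ 2.
Proof.
move=> c0.
have ballE : dilate c (unit_ball F n) = [set y | dotv y y <= c ^+ 2].
  by apply/seteqP; split => y /(dilate_ball _ y c0).
rewrite ballE; split=> [[clx nintx]|xc].
  have clB : closed [set y : 'rV[F]_n | dotv y y <= c ^+ 2].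
    apply: (@closed_comp _ _ (fun y : 'rV[F]_n => dotv y y)
      [set t | t <= c ^+ 2]); last exact: closed_le.
    by move=> y _; exact: continuous_sqnorm.
  apply/eqP; rewrite eq_le (clB _ clx) /= leNgt; apply/negP => xlt.
  apply: nintx.
  have : [set y : 'rV[F]_n | dotv y y < c ^+ 2] `<=`
      interior [set y | dotv y y <= c ^+ 2]; last exact.
  by rewrite -(open_subsetE _ (open_sqnorm_lt _)) => y /= /ltW.
split; first by apply: subset_closure; rewrite /= xc.
rewrite -[x]scale1r => /interior_scale_right near1.
have : \forall s \near (1 : F)^'+, False.
  apply: filterS2 near1 (nbhs_right_gt 1) => s /= + s1.
  rewrite dotvZl dotvZr xc mulrA -expr2 ger_pMl ?exprn_gt0//.
  have s0 : 0 <= s by exact: ltW (lt_trans ltr01 s1).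
  by rewrite expr_le1// leNgt s1.
by move/filter_ex => [].
Qed.

Lemma contact_sqnorm (c : F) x : 0 < c -> contact K c x -> dotv x x = c ^+ 2.
Proof. by move=> c0 [_ /(bd_ball _ x c0)]. Qed.

Lemma body_closed : closed K.
Proof. exact: compact_closed (@norm_hausdorff _ _) cK. Qed.

Lemma bd_body x : bd K x -> K x.
Proof. by move=> [+ _]; exact: body_closed. Qed.

Lemma compact_bd_body : compact (bd K).
Proof.
apply: subclosed_compact cK bd_body; apply: closedI.
  exact: closed_closure.
by rewrite closedC; exact: open_interior.
Qed.

Lemma compact_contact (c : F) : 0 < c -> compact (contact K c).
Proof.
move=> c0; apply: (subclosed_compact _ compact_bd_body) => [|x []//].
have -> : contact K c = bd K `&` [set x | dotv x x = c ^+ 2].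
  by apply/seteqP; split => x [Kx /(bd_ball _ x c0)].
apply: closedI.
  exact: compact_closed (@norm_hausdorff _ _) compact_bd_body.
apply: (@closed_comp _ _ (fun x : 'rV[F]_n => dotv x x) [set t | t = c ^+ 2]).
  by move=> x _; exact: continuous_sqnorm.
exact: closed_eq.
Qed.

Lemma body_sqnorm_le x : K x -> dotv x x <= R ^+ 2.
Proof. by move=> /hout /(dilate_ball _ _ hR). Qed.

Lemma outer_contact x : K x -> dotv x x = R ^+ 2 -> contact K R x.
Proof.
move=> Kx xR; have [_ nint] := (bd_ball _ x hR).2 xR.
split; last by apply/(bd_ball _ x hR).
split; first exact: subset_closure.
by move=> ix; apply: nint; exact: interiorS hout _ ix.
Qed.

Lemma bd_sqnorm_ge x : bd K x -> r ^+ 2 <= dotv x x.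
Proof.
move=> [_ nint]; rewrite leNgt; apply/negP => xlt; apply: nint.
have : [set y : 'rV[F]_n | dotv y y < r ^+ 2] `<=` interior K; last exact.
rewrite -(open_subsetE _ (open_sqnorm_lt _)).
by move=> y /= /ltW ylt; apply: hin; apply/dilate_ball.
Qed.

Lemma inner_contact x : bd K x -> dotv x x = r ^+ 2 -> contact K r x.
Proof. by move=> bx xr; split => //; apply/(bd_ball _ x hr). Qed.

Lemma body0 : K 0.
Proof.
by apply: hin; apply/dilate_ball; rewrite // dotvE mul0mx mxE sqr_ge0.
Qed.

(** The last point of K on the segment from 0 to x is a boundary point. *)
Lemma segment_meets_bd x : ~ K x ->
  exists t : F, [/\ 0 <= t, t < 1 & bd K (t *: x)].
Proof.
move=> nKx.
pose A := `[0, 1]%classic `&` [set t : F | K (t *: x)].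
have clA : closed [set t : F | K (t *: x)].
  apply: (@closed_comp _ _ (fun t : F => t *: x) K); last exact: body_closed.
  by move=> t _; exact: continuous_scaler.
have cA : compact A.
  exact: compact_closedI (@segment_compact F 0 1) clA.
have A0 : A !=set0.
  by exists 0; split; rewrite /= ?in_itv/= ?lexx ?ler01// scale0r; exact: body0.
have cid : {within A, continuous (id : F -> F)}.
  by apply: continuous_subspaceT => t; exact: cvg_id.
have [t + tmax] := compact_EVT_max A0 cA cid.
rewrite inE => -[/=]; rewrite in_itv/= => /andP[t0 t1] Ktx.
have {}t1 : t < 1.
  by rewrite lt_neqAle t1 andbT; apply/eqP => t1'; rewrite t1' scale1r in Ktx.
exists t; split => //; split; first exact: subset_closure.
move=> /interior_scale_right near_t.
have : \forall s \near t^'+, False.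
  apply: filterS3 near_t (nbhs_right_gt t) (nbhs_right_lt t1) => s Ks ts s1.
  have : s \in A.
    by rewrite inE; split => //=; rewrite in_itv/= !ltW// (le_lt_trans t0).
  by move/tmax; rewrite leNgt ts.
by move/filter_ex => [].
Qed.

End ContactPoints.

(** * The distance to the ball in terms of ellipsoids *)

(** K is contained in an ellipsoid E and E in rho K, where E is the image of the
    unit ball under M^-1.  Working with the inverse of the operator T of the
    distance describes E by the quadratic inequality |x M| <= 1. *)
Definition sandwich {F : realType} {n : nat} (K : set 'rV[F]_n) (rho : F) :=
  exists M : 'M[F]_n, [/\ M \in unitmx,
    forall x, K x -> dotv (x *m M) (x *m M) <= 1 &
    forall x, dotv (x *m M) (x *m M) <= 1 -> K (rho^-1 *: x)].

Lemma unitmx_trivial_kernel {F : fieldType} {n : nat} (M : 'M[F]_n) :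
  (forall v : 'rV[F]_n, v *m M = 0 -> v = 0) -> M \in unitmx.
Proof.
move=> Minj; rewrite unitmxE unitfE; apply/negP => /det0P[v v0 vM].
by move/eqP: v0; apply; exact: Minj.
Qed.

Section Distance.
Context {F : realType} {n : nat} {K : set 'rV[F]_n} {R r : F}.
Hypotheses (hK : convex_body K) (hsym : origin_symmetric K).
Hypotheses (hr : 0 < r) (hR : 0 < R).
Hypotheses (hin : dilate r (unit_ball F n) `<=` K)
           (hout : K `<=` dilate R (unit_ball F n)).
Implicit Types x : 'rV[F]_n.

Lemma unit_ballE x : unit_ball F n x <-> dotv x x <= 1.
Proof. by rewrite /unit_ball/= enorm_le// expr1n. Qed.

Lemma body_opp x : K x -> K (- x).
Proof. by move=> Kx; rewrite -hsym; exists x. Qed.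

Lemma body_mid x y : K x -> K y -> K (2^-1 *: (x + y)).
Proof.
move=> Kx Ky; have [_ cvx _] := hK.
have h01 : 0 <= (2^-1 : F) <= 1 by lra.
have := cvx x y (Itv01 (proj1 (andP h01)) (proj2 (andP h01))).
rewrite !inE => /(_ Kx Ky); rewrite /conv/=.
have -> : unstable.onem 2^-1 = 2^-1 :> F by rewrite /unstable.onem; lra.
by rewrite -scalerDr.
Qed.

(** Each inclusion is applied to a point and to its opposite: subtracting the
    two results cancels the translations and exhibits x M as a midpoint of two
    points of the ball, respectively rho^-1 x as a midpoint of two points of
    K. *)
Lemma sandwich_of_linear (rho : F) (T : {linear 'rV[F]_n -> 'rV[F]_n})
    (u v : 'rV[F]_n) : 0 < rho -> bijective T ->
  translate u K `<=` T @` translate v (unit_ball F n) ->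
  T @` translate v (unit_ball F n) `<=` dilate rho (translate u K) ->
  sandwich K rho.
Proof.
move=> rho0 bT KT TK.
have uT : lin1_mx T \in unitmx.
  apply: unitmx_trivial_kernel => w; rewrite mul_rV_lin1 => Tw.
  by apply: (bij_inj bT); rewrite Tw linear0.
have TE w : w = T w *m invmx (lin1_mx T) by rewrite -mul_rV_lin1 mulmxK.
have TV w : T (w *m invmx (lin1_mx T)) = w by rewrite -mul_rV_lin1 mulmxKV.
exists (invmx (lin1_mx T)); split; first by rewrite unitmx_inv.
  move=> x Kx.
  have hit w : K w -> exists2 b, dotv b b <= 1 &
      (w + u) *m invmx (lin1_mx T) = b + v.
    move=> Kw; have [|_ [b /unit_ballE bB <-] <-] := KT (w + u).
      by exists w.
    by exists b => //; rewrite -TE.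
  have [b bB be] := hit _ Kx; have [b' bB' be'] := hit _ (body_opp _ Kx).
  have -> : x *m invmx (lin1_mx T) = 2^-1 *: (b + -1 *: b').
    move: be be'; rewrite !mulmxDl mulNmx.
    move: (x *m _) (u *m _) => X U /rowP be /rowP be'.
    by apply/rowP => i; have := be i; have := be' i; rewrite !mxE; lra.
  (* Parallelogram law: |b - b'|^2 + |b + b'|^2 = 2 |b|^2 + 2 |b'|^2 <= 4. *)
  have := dotv_ge0 (b + b').
  rewrite !(dotvDl, dotvDr, dotvZl, dotvZr) (dotvC b' b); lra.
move=> x xB; set b := x *m _ in xB.
have hit w : dotv w w <= 1 -> exists2 y, K y & T w + T v = rho *: (y + u).
  move=> wB; have [|_ [y Ky <-] e] := TK (T (w + v)).
    by exists (w + v) => //; exists w => //; apply/unit_ballE.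
  by exists y => //; rewrite -linearD.
have [y Ky ye] := hit _ xB.
have [|y' Ky' ye'] := hit (-1 *: b).
  by rewrite dotvZl dotvZr; lra.
have -> : rho^-1 *: x = 2^-1 *: (y + - y').
  have Tb : T b = x by rewrite /b TV.
  move: ye ye'; rewrite linearZ/= Tb => /rowP ye /rowP ye'.
  apply/rowP => i; have := ye i; have := ye' i; rewrite !mxE => e1 e2.
  have -> : x ord0 i = 2^-1 * (rho * (y ord0 i - y' ord0 i)) by lra.
  by rewrite mulrCA mulKf// gt_eqF.
by apply: body_mid => //; exact: body_opp.
Qed.

Lemma linear_of_sandwich (rho : F) : 0 < rho -> sandwich K rho ->
  exists (T : {linear 'rV[F]_n -> 'rV[F]_n}) (u v : 'rV[F]_n),
    [/\ bijective T,
        translate u K `<=` T @` translate v (unit_ball F n) &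
        T @` translate v (unit_ball F n) `<=` dilate rho (translate u K)].
Proof.
move=> rho0 [M [uM KM MK]]; exists (mulmxr (invmx M)), 0, 0; split.
- exists (mulmxr M) => x /=; first by rewrite mulmxKV.
  by rewrite mulmxK.
- move=> _ [x Kx <-]; exists (x *m M); last by rewrite /= mulmxK// addr0.
  by exists (x *m M); rewrite ?addr0//; apply/unit_ballE; exact: KM.
- move=> _ [_ [b /unit_ballE bB <-] <-] /=; rewrite addr0.
  exists (rho^-1 *: (b *m invmx M)).
    exists (rho^-1 *: (b *m invmx M)); rewrite ?addr0//.
    by apply: MK; rewrite mulmxKV.
  by rewrite scalerA divff ?scale1r// gt_eqF.
Qed.

Lemma dBM_setE : [set rho : F | 0 < rho /\
    exists (T : {linear 'rV[F]_n -> 'rV[F]_n}) (u v : 'rV[F]_n),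
      [/\ bijective T,
          translate u K `<=` T @` translate v (unit_ball F n) &
          T @` translate v (unit_ball F n) `<=` dilate rho (translate u K)]] =
  [set rho | 0 < rho /\ sandwich K rho].
Proof.
apply/seteqP; split => rho [rho0].
  move=> [T [u [v [bT KT TK]]]]; split=> //.
  exact: sandwich_of_linear bT KT TK.
by move=> s; split=> //; exact: linear_of_sandwich.
Qed.

Lemma sandwich_ratio : sandwich K (R / r).
Proof.
exists (R^-1)%:M; split.
- by rewrite unitmxE det_scalar unitrX// unitfE invr_eq0 gt_eqF.
- move=> x Kx; rewrite mul_mx_scalar dotvZl dotvZr mulrA -expr2 exprVn mulrC.
  by rewrite ler_pdivrMr ?exprn_gt0// mul1r (body_sqnorm_le hR hout).
- move=> x; rewrite mul_mx_scalar dotvZl dotvZr mulrA -expr2 exprVn mulrC.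
  rewrite ler_pdivrMr ?exprn_gt0// mul1r => xR.
  apply: hin; apply/dilate_ball => //; rewrite dotvZl dotvZr mulrA -expr2.
  rewrite invf_div expr_div_n mulrAC ler_pdivrMr ?exprn_gt0//.
  by rewrite ler_pM2l// exprn_gt0.
Qed.

(** R / r is always an admissible ratio, so the infimum equals R / r as soon as
    R / r is a lower bound. *)
Lemma dBM_eq_ratio :
  dBM K (unit_ball F n) = R / r <->
  (forall rho, 0 < rho -> sandwich K rho -> R / r <= rho).
Proof.
rewrite /dBM dBM_setE; set S := [set rho | _].
have S_ratio : S (R / r) by split; [exact: divr_gt0|exact: sandwich_ratio].
have lbS : has_lbound S by exists 0 => rho [/ltW].
split=> [<- rho rho0 s|h]; first exact: ge_inf.
apply/eqP; rewrite eq_le ge_inf//=.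
by apply: lb_le_inf => [|rho [rho0 s]]; [exists (R / r)|exact: h].
Qed.

End Distance.

(** * Separating forms and contact decompositions *)

Section Perturb.
Context {F : realType} {n : nat} {K : set 'rV[F]_n} {R r : F}.
Hypotheses (cK : compact K) (hr : 0 < r) (hR : 0 < R).
Hypotheses (hin : dilate r (unit_ball F n) `<=` K)
           (hout : K `<=` dilate R (unit_ball F n)).
Implicit Types x : 'rV[F]_n.

Lemma sqnorm_perturb (A : 'M[F]_n) (e : F) x :
  dotv (x *m (1%:M + e *: A)) (x *m (1%:M + e *: A)) =
  dotv x x + e * (2 * dotv x (x *m A) + e * dotv (x *m A) (x *m A)).
Proof.
rewrite mulmxDr mulmx1 -scalemxAr !(dotvDl, dotvDr, dotvZl, dotvZr).
by rewrite (dotvC (x *m A) x); ring.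
Qed.

Lemma continuous_form (A : 'M[F]_n) :
  continuous (fun x : 'rV[F]_n => dotv x (x *m A)).
Proof.
have -> : (fun x : 'rV[F]_n => dotv x (x *m A)) =
    fun x => dotv (x *m 1%:M) (x *m A).
  by apply/funext => x; rewrite mulmx1.
exact: continuous_dotv.
Qed.

(** A form that is negative at the outer and positive at the inner contact
    points improves the ratio: with T = 1 + e A the ellipsoids |x T|^2 <= d and
    |x T|^2 <= c, where r^2 < d and c < R^2, lie respectively inside and around
    K.  Perturbing the operator rather than the form keeps the perturbed form a
    square, so no square root of a matrix has to be taken. *)
Lemma sandwich_perturb (A : 'M[F]_n) :
  (forall y, contact K R y -> dotv y (y *m A) < 0) ->
  (forall z, contact K r z -> 0 < dotv z (z *m A)) ->
  exists rho, [/\ 0 < rho, rho < R / r & sandwich K rho].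
Proof.
move=> Aout Ain.
pose g x := dotv x x; pose h x := 2 * dotv x (x *m A).
pose k x := dotv (x *m A) (x *m A).
have gc : continuous g by exact: continuous_sqnorm.
have hc : continuous h.
  apply: continuous_mul; last exact: continuous_form.
  exact: cst_continuous.
have kc : continuous k by exact: continuous_dotv.
have outK : \forall e \near (0 : F)^'+, forall x, K x ->
    g x + e * (h x + e * k x) < R ^+ 2.
  apply: (compact_perturb_lt cK) => // x Kx.
    exact: body_sqnorm_le hR hout _ Kx.
  move=> /(outer_contact hR hout _ Kx) /Aout; rewrite /h; lra.
have inK : \forall e \near (0 : F)^'+, forall x, bd K x ->
    - g x + e * (- h x + e * - k x) < - r ^+ 2.
  apply: (compact_perturb_lt (compact_bd_body cK)) => [|||x Kx|x Kx].
  - exact: continuous_opp.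
  - exact: continuous_opp.
  - exact: continuous_opp.
  - by rewrite lerN2 (bd_sqnorm_ge hr hin).
  - by move=> /oppr_inj /(inner_contact hr _ Kx) /Ain; rewrite /h; lra.
have [e [eout ein]] := filter_ex (filterI outK inK).
pose T := 1%:M + e *: A; pose f x := dotv (x *m T) (x *m T).
have fE x : f x = g x + e * (h x + e * k x) by exact: sqnorm_perturb.
have fc : continuous f by exact: continuous_dotv.
have [c [fKc c0 cR]] : exists c,
    [/\ forall x, K x -> f x < c, 0 < c & c < R ^+ 2].
  have fK x : K x -> f x < R ^+ 2 by rewrite fE; exact: eout.
  by have [c []] := compact_lt_gap cK f _ _ fc (exprn_gt0 2 hR) fK; exists c.
(* The lower limit of the gap is arbitrary: only d > r^2 matters. *)
have [d [fKd rd]] : exists d, (forall x, bd K x -> d < f x) /\ r ^+ 2 < d.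
  have fK x : bd K x -> - f x < - r ^+ 2.
    by move=> Kx; have := ein _ Kx; rewrite fE; lra.
  have [|d [_ dr fd]] := compact_lt_gap (compact_bd_body cK) _ (- r ^+ 2 - 1) _
    (continuous_opp f fc) _ fK; first by lra.
  by exists (- d); split=> [x Kx|]; [rewrite ltrNl fd|rewrite ltrNr].
have d0 : 0 < d by apply: lt_trans rd; exact: exprn_gt0.
have f_ge0 x : 0 <= f x by exact: dotv_ge0.
have fZ (t : F) x : f (t *: x) = t ^+ 2 * f x.
  by rewrite /f -scalemxAl dotvZl dotvZr mulrA -expr2.
have fdK x : f x <= d -> K x.
  move=> fx; apply: contrapT => /(segment_meets_bd cK hr hin)[t [t0 t1 /fKd]].
  rewrite fZ; apply/negP; rewrite -leNgt; apply: le_trans fx.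
  by rewrite ler_piMl// expr_le1// ltW.
(* A kernel vector v would put the whole line spanned by v inside K; the
   multiple a is chosen so that a v is outside the ball of radius R. *)
have uT : T \in unitmx.
  apply: unitmx_trivial_kernel => v vT; apply/eqP.
  rewrite -dotv_eq0; apply/negPn/negP => v0.
  have {}v0 : 0 < dotv v v by rewrite lt_neqAle eq_sym v0 dotv_ge0.
  pose a := 1 + R ^+ 2 / dotv v v.
  have a1 : 1 <= a by rewrite lerDl divr_ge0 ?sqr_ge0// ltW.
  have Kav : K (a *: v).
    by apply: fdK; rewrite fZ /f vT dotvE mul0mx mxE mulr0 ltW.
  have := body_sqnorm_le hR hout _ Kav.
  rewrite dotvZl dotvZr; apply/negP; rewrite -ltNge.
  apply: (@lt_le_trans _ _ (a * dotv v v)).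
    by rewrite mulrDl mul1r divfK ?gt_eqF// ltrDr.
  by rewrite ler_peMl// mulr_ge0 ?(ltW v0)// (le_trans ler01).
have cd0 : 0 <= c / d by rewrite divr_ge0// ltW.
exists (Num.sqrt (c / d)); split.
- by rewrite sqrtr_gt0 divr_gt0.
- rewrite -(ltr_sqr (sqrtr_ge0 _)) ?nnegrE ?(ltW (divr_gt0 hR hr))//.
  rewrite (sqr_sqrtr cd0) expr_div_n.
  by rewrite ltr_pM// ?invr_ge0 ?ltW// ltf_pV2// posrE exprn_gt0.
exists ((Num.sqrt c)^-1 *: T).
have NE x : dotv (x *m ((Num.sqrt c)^-1 *: T)) (x *m ((Num.sqrt c)^-1 *: T)) =
    f x / c.
  rewrite -scalemxAr dotvZl dotvZr mulrA -expr2 exprVn sqr_sqrtr ?ltW//.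
  by rewrite mulrC.
split.
- by rewrite unitmxZ// unitfE invr_eq0 gt_eqF// sqrtr_gt0.
- by move=> x Kx; rewrite NE ler_pdivrMr// mul1r ltW// fKc.
- move=> x; rewrite NE ler_pdivrMr// mul1r => fxc; apply: fdK.
  rewrite fZ exprVn (sqr_sqrtr cd0) invf_div mulrAC.
  by rewrite ler_pdivrMr// ler_pM2l.
Qed.

(** On the sphere of radius c the form of b%:M is the constant b c^2, so a
    multiple of the identity placed strictly between the normalized values of A
    at outer and at inner contact points can be subtracted. *)
Lemma separating_form (A : 'M[F]_n) :
  (forall y z, contact K R y -> contact K r z ->
    dotv y (y *m A) / R ^+ 2 < dotv z (z *m A) / r ^+ 2) ->
  exists B : 'M[F]_n, (forall y, contact K R y -> dotv y (y *m B) < 0) /\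
    (forall z, contact K r z -> 0 < dotv z (z *m B)).
Proof.
move=> sepA.
have [outer0|/set0P outer0] := eqVneq (contact K R) set0.
  exists 1%:M; split=> [y|z zr]; first by rewrite outer0.
  by rewrite mulmx1 (contact_sqnorm _ _ hr zr) exprn_gt0.
pose f x := dotv x (x *m A); have fc : continuous f by exact: continuous_form.
have [y + fy] := compact_EVT_max outer0 (compact_contact cK R hR)
  (continuous_subspaceT fc).
rewrite inE => yR.
pose a := f y / R ^+ 2.
have r2 : 0 < r ^+ 2 by exact: exprn_gt0.
have R2 : 0 < R ^+ 2 by exact: exprn_gt0.
have [m [ma fm]] : exists m,
    a < m /\ forall z, contact K r z -> m * r ^+ 2 < f z.
  have fK z : contact K r z -> - f z < - (a * r ^+ 2).
    by move=> zr; rewrite ltrN2 -ltr_pdivlMr//; exact: sepA.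
  have [|d [_ dr fd]] := compact_lt_gap (compact_contact cK r hr) _
    (- (a * r ^+ 2) - 1) _ (continuous_opp f fc) _ fK; first by lra.
  exists (- d / r ^+ 2); split=> [|z zr]; first by rewrite ltr_pdivlMr// ltrNr.
  by rewrite divfK ?gt_eqF// ltrNl fd.
(* The midpoint of a and m makes both inequalities strict. *)
pose b := (a + m) / 2.
have fB x : dotv x (x *m (A - b%:M)) = f x - b * dotv x x.
  by rewrite mulmxBr mul_mx_scalar -scaleNr dotvDr dotvZr mulNr.
exists (A - b%:M); split=> [x xR|z zr]; rewrite fB.
  rewrite (contact_sqnorm _ _ hR xR) subr_lt0 -ltr_pdivrMr//.
  apply: (@le_lt_trans _ _ a); last by rewrite /b; lra.
  by rewrite ler_pM2r ?invr_gt0// fy// inE.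
rewrite (contact_sqnorm _ _ hr zr) subr_gt0; apply: lt_trans (fm _ zr).
by rewrite ltr_pM2r// /b; lra.
Qed.

Section Decomposition.
Context {N M : nat} {y : 'I_N -> 'rV[F]_n} {z : 'I_M -> 'rV[F]_n}.
Context {lambda : 'I_N -> F} {mu : 'I_M -> F}.
Hypothesis dec : contact_decomposition K R r y z lambda mu.

(** A quadratic form C takes at y the value trace (C y^T y), which is linear in
    y^T y. *)
Lemma decomposition_form (C : 'M[F]_n) :
  \sum_i lambda i * dotv (y i) (y i *m C) =
  \sum_j mu j * dotv (z j) (z j *m C).
Proof.
have [_ _ _ deq] := dec.
have dyadE : \sum_i lambda i *: ((y i)^T *m y i) =
    \sum_j mu j *: ((z j)^T *m z j).
  apply/row_matrixP => k; rewrite !rowE !mulmx_sumr.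
  under eq_bigr do rewrite -dotv_scale_dyad.
  by under [RHS]eq_bigr do rewrite -dotv_scale_dyad.
have := congr1 (fun P => \tr (C *m P)) dyadE.
rewrite /= !mulmx_sumr !raddf_sum/=.
under eq_bigr do rewrite -scalemxAr mxtraceZ -dotv_form.
by under [X in _ = X -> _]eq_bigr do rewrite -scalemxAr mxtraceZ -dotv_form.
Qed.

Lemma decomposition_trace :
  R ^+ 2 * \sum_i lambda i = r ^+ 2 * \sum_j mu j.
Proof.
have [_ [yR zr] _ _] := dec; have := decomposition_form 1%:M.
under eq_bigr do rewrite mulmx1 (contact_sqnorm _ _ hR (yR _)) mulrC.
under [X in _ = X -> _]eq_bigr do
  rewrite mulmx1 (contact_sqnorm _ _ hr (zr _)) mulrC.
by rewrite -!mulr_sumr.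
Qed.

(** Points with |x T| < rho^-1 form an open subset of K, hence contain no
    boundary point. *)
Lemma sandwich_contact_ge rho (T : 'M[F]_n) (x : 'rV[F]_n) : 0 < rho ->
  (forall x, dotv (x *m T) (x *m T) <= 1 -> K (rho^-1 *: x)) ->
  bd K x -> (rho ^+ 2)^-1 <= dotv (x *m T) (x *m T).
Proof.
move=> rho0 TK [_ nint]; rewrite leNgt; apply/negP => xlt; apply: nint.
have opU : open [set x : 'rV[F]_n | dotv (x *m T) (x *m T) < (rho ^+ 2)^-1].
  apply: (@open_comp _ _ (fun x : 'rV[F]_n => dotv (x *m T) (x *m T))
    [set t | t < (rho ^+ 2)^-1]); last exact: open_lt.
  by move=> v _; exact: continuous_dotv.
have : [set x : 'rV[F]_n | dotv (x *m T) (x *m T) < (rho ^+ 2)^-1] `<=`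
    interior K; last exact.
rewrite -(open_subsetE _ opU) => v /= vlt.
have rho_neq0 : rho != 0 by rewrite gt_eqF.
rewrite -[v]scale1r -(mulVf rho_neq0) -scalerA; apply: TK.
rewrite -scalemxAl dotvZl dotvZr mulrA -expr2 -ler_pdivlMl ?exprn_gt0//.
by rewrite mulr1 ltW.
Qed.

Lemma sandwich_lower_bound rho : 0 < rho -> sandwich K rho -> R / r <= rho.
Proof.
move=> rho0 [T [uT KT TK]].
have [[N1 M1] [yR zr] [lambda0 mu0] _] := dec.
set L := \sum_i lambda i; set U := \sum_j mu j.
have L0 : 0 < L.
  rewrite /L (bigD1 (Ordinal N1))//= ltr_wpDr// sumr_ge0// => i _.
  exact: ltW.
have LU : (rho ^+ 2)^-1 * U <= L.
  have le1 : \sum_i lambda i * dotv (y i) (y i *m (T *m T^T)) <= L.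
    apply: ler_sum => i _; rewrite -dotv_mulmx ler_piMr ?(ltW (lambda0 i))//.
    by apply: KT; apply: (bd_body cK); have [] := yR i.
  apply: le_trans le1; rewrite decomposition_form mulr_sumr.
  apply: ler_sum => j _; rewrite -dotv_mulmx mulrC ler_pM2l//.
  by apply: sandwich_contact_ge rho0 TK _; have [] := zr j.
rewrite ler_pdivrMr// -ler_sqr ?nnegrE ?(ltW hR) ?(ltW (mulr_gt0 rho0 hr))//.
rewrite exprMn -(ler_pM2r L0) decomposition_trace -/U (mulrC (rho ^+ 2)).
rewrite -(mulrA (r ^+ 2)) ler_pM2l ?exprn_gt0//.
by rewrite -ler_pdivrMl ?exprn_gt0.
Qed.

End Decomposition.

End Perturb.

(** * Convex combinations and a compact theorem of the alternative *)

Section Caratheodory.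
Context {F : realType} {m : nat}.
Implicit Types (S : set 'rV[F]_m) (p : 'rV[F]_m).

Definition conv_comb k S p := exists (w : 'I_k -> F) (s : 'I_k -> 'rV[F]_m),
  [/\ forall i, 0 <= w i, \sum_i w i = 1, forall i, S (s i) &
      p = \sum_i w i *: s i].

Definition affinely_dependent k (s : 'I_k -> 'rV[F]_m) :=
  exists c : 'I_k -> F,
    [/\ exists i, c i != 0, \sum_i c i = 0 & \sum_i c i *: s i = 0].

(** Caratheodory's step: moving the weights along an affine dependence keeps
    the point fixed, until a first weight vanishes. *)
Lemma conv_comb_reduce k S p :
  (forall s : 'I_k.+1 -> 'rV[F]_m, (forall i, S (s i)) ->
    affinely_dependent k.+1 s) ->
  conv_comb k.+1 S p -> conv_comb k S p.
Proof.
move=> dep [w [s [w0 w1 Ss ->]]]; have [c [[i ci] c0 cs]] := dep s Ss.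
have [i1 ci1] : exists i, 0 < c i.
  apply: contrapT => /forallNP cneg; move/eqP: ci; apply.
  have nc0 : \sum_i - c i = 0 by rewrite sumrN c0 oppr0.
  have nc_ge0 j : true -> 0 <= - c j.
    by rewrite oppr_ge0 leNgt; move/negP: (cneg j).
  have := @psumr_eq0P _ _ _ _ nc_ge0 nc0 i isT.
  by move/eqP; rewrite oppr_eq0 => /eqP.
(* The index whose weight vanishes first when t grows in w - t c. *)
pose i0 := [arg min_(j < i1 | 0 < c j) (w j / c j)]%O.
have [ci0 tmin] : 0 < c i0 /\ forall j, 0 < c j -> w i0 / c i0 <= w j / c j.
  by rewrite /i0; case: Order.TotalTheory.arg_minP.
set t := w i0 / c i0 in tmin; pose w' j := w j - t * c j.
have t0 : 0 <= t by rewrite divr_ge0// ltW.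
have w'0 j : 0 <= w' j.
  rewrite subr_ge0; have [cj|cj] := ltP 0 (c j).
    by rewrite -ler_pdivlMr// tmin.
  by apply: le_trans (w0 j); rewrite mulr_ge0_le0.
have w'i0 : w' i0 = 0 by rewrite /w' divfK ?subrr// gt_eqF.
exists (w' \o lift i0), (s \o lift i0); split=> /=.
- by move=> j; exact: w'0.
- transitivity (\sum_j w' j); first by rewrite (bigD1_ord i0)//= w'i0 add0r.
  by rewrite sumrB -mulr_sumr c0 mulr0 subr0.
- by move=> j; exact: Ss.
transitivity (\sum_j w' j *: s j).
  under [RHS]eq_bigr do rewrite scalerBl -scalerA.
  by rewrite sumrB -scaler_sumr cs scaler0 subr0.
by rewrite (bigD1_ord i0)//= w'i0 scale0r add0r.
Qed.

Lemma conv_comb_segment k S p s (t : F) : 0 <= t -> t <= 1 ->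
  conv_comb k S p -> S s -> conv_comb k.+1 S (t *: s + (1 - t) *: p).
Proof.
move=> t0 t1 [w [u [w0 w1 Su ->]]] Ss.
exists (fun i => if unlift ord0 i is Some j then (1 - t) * w j else t).
exists (fun i => if unlift ord0 i is Some j then u j else s); split.
- by move=> i; case: unliftP => // j _; rewrite mulr_ge0// subr_ge0.
- rewrite big_ord_recl unlift_none.
  under eq_bigr do rewrite liftK.
  by rewrite -mulr_sumr w1 mulr1 addrC subrK.
- by move=> i; case: unliftP.
- rewrite big_ord_recl !unlift_none; congr (_ + _).
  under [RHS]eq_bigr do rewrite !liftK.
  by rewrite scaler_sumr; apply: eq_bigr => i _; rewrite scalerA.
Qed.

(** Fixing the number of points makes the set of convex combinations a
    continuous image of the compact product of S^(k+1) and the simplex. *)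
Lemma conv_comb_min k S : compact S -> S !=set0 ->
  exists2 p, conv_comb k.+1 S p &
    forall q, conv_comb k.+1 S q -> dotv p p <= dotv q q.
Proof.
move=> cS [s0 Ss0].
pose Sk := [set v : 'rV['rV[F]_m]_k.+1 | forall i, S (v ord0 i)].
pose W := [set w : 'rV[F]_k.+1 | forall i, `[0, 1]%classic (w ord0 i)] `&`
  [set w | \sum_i w ord0 i = 1].
have cW : compact W.
  apply: compact_closedI.
    exact: (@rV_compact F _ (fun=> `[0, 1]%classic)
      (fun=> @segment_compact F 0 1)).
  apply: (@closed_comp _ _ (fun w : 'rV[F]_k.+1 => \sum_i w ord0 i)
    [set t | t = 1]); last exact: closed_eq.
  by move=> w _; apply: continuous_sum => i; exact: continuous_entry.
have cSk : compact Sk.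
  exact: (@rV_compact 'rV[F]_m _ (fun=> S) (fun=> cS)).
pose bary (v : 'rV['rV[F]_m]_k.+1 * 'rV[F]_k.+1) : 'rV[F]_m :=
  \sum_i v.2 ord0 i *: v.1 ord0 i.
pose f v := dotv (bary v) (bary v).
have baryc j : continuous (fun v => bary v ord0 j).
  have -> : (fun v => bary v ord0 j) =
      fun v => \sum_i v.2 ord0 i * v.1 ord0 i ord0 j.
    by apply/funext => v; rewrite summxE; apply: eq_bigr => i _; rewrite mxE.
  apply: continuous_sum => i; apply: continuous_mul => v.
    apply: (cvg_comp snd (fun w : 'rV[F]_k.+1 => w ord0 i) cvg_snd).
    exact: continuous_entry.
  apply: (cvg_comp fst (fun u : 'rV['rV[F]_m]_k.+1 => u ord0 i ord0 j) cvg_fst).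
  apply: (cvg_comp (fun u : 'rV['rV[F]_m]_k.+1 => u ord0 i)
    (fun x : 'rV[F]_m => x ord0 j)); exact: continuous_entry.
have fc : continuous f by apply: continuous_sum => j; exact: continuous_mul.
have combE q : conv_comb k.+1 S q <-> exists2 v, (Sk `*` W) v & q = bary v.
  split=> [[w [s [w0 w1 Ss ->]]]|[[v w] [/= Sv [/= w01 w1]] ->]].
    exists (\row_i s i, \row_i w i); last first.
      by apply: eq_bigr => i _; rewrite !mxE.
    split=> /=; first by move=> i; rewrite mxE.
    split=> [i|] /=; last by under eq_bigr do rewrite mxE.
    by rewrite mxE in_itv/= w0/= -w1 (bigD1 i)//= lerDl sumr_ge0.
  exists (fun i => w ord0 i), (fun i => v ord0 i); split=> // i.
  by have := w01 i; rewrite in_itv/= => /andP[].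
have C0 : (Sk `*` W) !=set0.
  have : conv_comb k.+1 S s0.
    exists (fun i => (i == ord0)%:R), (fun=> s0); split=> //.
    - by rewrite big_ord_recl/= big1 ?addr0// => i _.
    - by rewrite big_ord_recl/= big1 ?addr0 ?scale1r// => i _; rewrite scale0r.
  by move/combE => [v Cv _]; exists v.
have [v] := compact_EVT_min C0 (compact_setX cSk cW) (continuous_subspaceT fc).
rewrite inE => Cv vmin; exists (bary v); first by apply/combE; exists v.
by move=> _ /combE[u Cu ->]; apply: vmin; rewrite inE.
Qed.

(** Gordan's alternative for a compact set.  The point p of least norm among the
    combinations of k + 1 elements either is 0 or satisfies
    <p, s> >= |p|^2 > 0 on S: otherwise p could be shortened by moving towards
    s, and the resulting combination of k + 2 elements reduces to k + 1. *)
Lemma gordan_compact k S : compact S -> S !=set0 ->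
  (forall s : 'I_k.+2 -> 'rV[F]_m, (forall i, S (s i)) ->
    affinely_dependent k.+2 s) ->
  conv_comb k.+1 S 0 \/ exists a, forall s, S s -> 0 < dotv a s.
Proof.
move=> cS S0 dep; have [p pS pmin] := conv_comb_min k S cS S0.
have [p0|p0] := eqVneq p 0; first by left; rewrite -p0.
right; exists p => s Ss.
have pp : 0 < dotv p p by rewrite lt_neqAle eq_sym dotv_eq0 p0 dotv_ge0.
apply: lt_le_trans pp _; rewrite leNgt; apply/negP => ps.
pose d := dotv p p - dotv p s; pose q := dotv (s - p) (s - p).
have d0 : 0 < d by rewrite subr_gt0.
have q0 : 0 <= q by exact: dotv_ge0.
have qd : 0 < q + d by lra.
(* |p + t (s - p)|^2 = |p|^2 - t (2 d - t q), and t q < d for this t. *)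
pose t := d / (q + d).
have t0 : 0 < t by exact: divr_gt0.
have t1 : t <= 1 by rewrite ler_pdivrMr// mul1r; lra.
have tq : t * (q + d) = d by rewrite divfK// gt_eqF.
have /pmin := conv_comb_reduce _ _ _ dep
  (conv_comb_segment _ _ _ _ _ (ltW t0) t1 pS Ss).
have -> : dotv (t *: s + (1 - t) *: p) (t *: s + (1 - t) *: p) =
    dotv p p - t * (2 * d - t * q).
  rewrite /q /d -(scaleN1r p) !(dotvDl, dotvDr, dotvZl, dotvZr) (dotvC s p).
  clear t0 t1 tq; move: (dotv p p) (dotv p s) (dotv s s) t => pp' ps' ss' t'.
  ring.
apply/negP; rewrite -ltNge gtrBl pmulr_rgt0//.
have : 0 < t * d by exact: mulr_gt0.
lra.
Qed.

End Caratheodory.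

(** * Decompositions from quadratic forms *)

Lemma card_upper_triangle n :
  #|[pred p : 'I_n * 'I_n | (p.1 <= p.2)%N]| = (n * (n + 1) %/ 2)%N.
Proof.
have -> : (n * (n + 1) %/ 2)%N = 'C(n.+1, 2) by rewrite bin2 divn2 addn1 mulnC.
rewrite -bin2_sum big_mkord big_ord_recl add0n.
rewrite -sum1_card big_mkcond/=.
rewrite -(pair_big predT predT
  (fun i j : 'I_n => if (i <= j)%N then 1%N else 0%N))/=.
rewrite exchange_big/=; apply: eq_bigr => j _.
rewrite -big_mkcond/= -(big_ord_widen n (fun=> 1%N) (ltn_ord j)).
by rewrite sum_nat_const card_ord muln1.
Qed.

Lemma wide_kernel {F : fieldType} {k m : nat} (G : 'M[F]_(k, m)) :
  (m < k)%N -> exists2 v : 'rV[F]_k, v != 0 & v *m G = 0.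
Proof.
move=> mk; have : kermx G != 0.
  by rewrite kermx_eq0 /row_free neq_ltn (leq_ltn_trans (rank_leq_col G) mk).
by move/rowV0Pn => [v /sub_kermxP vG v0]; exists v.
Qed.

(** Symmetric matrices are determined by their n (n + 1) / 2 entries on and
    above the diagonal; the extra column of ones encodes that the coefficients
    of the dependence sum to 0. *)
Lemma symmetric_affinely_dependent {F : realType} {n k : nat}
    (s : 'I_k -> 'M[F]_n) :
  (n * (n + 1) %/ 2 + 1 < k)%N -> (forall i, (s i)^T = s i) ->
  affinely_dependent k (fun i => mxvec (s i)).
Proof.
move=> nk sym.
pose A := [pred p : 'I_n * 'I_n | (p.1 <= p.2)%N].
pose G := \matrix_(i < k, u < #|A| + 1)
  if fintype.split u is inl a then s i (enum_val a).1 (enum_val a).2 else 1.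
have [|v v0 vG] := wide_kernel G; first by rewrite card_upper_triangle.
have vGE (u : 'I_(#|A| + 1)) : \sum_i v ord0 i *
    (if fintype.split u is inl a then s i (enum_val a).1 (enum_val a).2
     else 1) = 0.
  transitivity ((v *m G) ord0 u); last by rewrite vG mxE.
  by rewrite mxE; apply: eq_bigr => i _; rewrite mxE.
exists (fun i => v ord0 i); split.
- by have /rV0Pn := v0.
- have := vGE (rshift #|A| ord0).
  case: fintype.splitP => [a /= ea|b _].
    by have := ltn_ord a; rewrite -ea addn0 ltnn.
  by under eq_bigr do rewrite mulr1.
have upper (a b : 'I_n) : (a <= b)%N -> \sum_i v ord0 i * s i a b = 0.
  move=> ab; have Aab : (a, b) \in A by rewrite inE.
  have := vGE (lshift 1 (enum_rank_in Aab (a, b))).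
  case: fintype.splitP => [c /= /ord_inj <-|c /= ec].
    by rewrite enum_rankK_in.
  by have := ltn_ord (enum_rank_in Aab (a, b)); rewrite ec ltnNge leq_addr.
have -> : \sum_i v ord0 i *: mxvec (s i) = mxvec (\sum_i v ord0 i *: s i).
  by rewrite linear_sum; apply: eq_bigr => i _; rewrite linearZ.
apply/eqP; rewrite mxvec_eq0; apply/eqP/matrixP => a b; rewrite summxE mxE.
under eq_bigr do rewrite mxE.
have [/upper //|/ltnW /upper ba] := leqP a b.
by under eq_bigr => i _ do rewrite -(sym i) mxE.
Qed.

Section Necessity.
Context {F : realType} {n : nat} {K : set 'rV[F]_n} {R r : F}.
Hypotheses (cK : compact K) (hr : 0 < r) (hR : 0 < R).
Hypotheses (hin : dilate r (unit_ball F n) `<=` K)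
           (hout : K `<=` dilate R (unit_ball F n)).

(** Matrices are flattened so that the inner product of vectors serves as the
    Frobenius inner product. *)
Definition dyad (x : 'rV[F]_n) : 'rV[F]_(n * n) := mxvec (x^T *m x).

Lemma dotv_dyad (A : 'M[F]_n) (x : 'rV[F]_n) :
  dotv (mxvec A) (dyad x) = dotv x (x *m A).
Proof. by rewrite dotvC dotvE mxvec_dotmul dotvC dotvE. Qed.

Lemma continuous_dyad : continuous dyad.
Proof.
apply: continuous_matrix => i j; case/mxvec_indexP: j => a b.
have -> : (fun x => dyad x i (mxvec_index a b)) = fun x => x ord0 a * x ord0 b.
  by apply/funext => x; rewrite ord1 /dyad mxvecE mxE big_ord1 mxE.
by apply: continuous_mul; exact: continuous_entry.
Qed.

Lemma dyad_sym (x : 'rV[F]_n) : (x^T *m x)^T = x^T *m x.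
Proof. by rewrite trmx_mul trmxK. Qed.

Definition signed_dyads : set 'rV[F]_(n * n) :=
  [set dyad y | y in contact K R] `|` [set - dyad z | z in contact K r].

Lemma compact_signed_dyads : compact signed_dyads.
Proof.
apply: compactU; apply: continuous_compact.
- by apply: continuous_subspaceT => x; exact: continuous_dyad.
- exact: compact_contact.
- apply: continuous_subspaceT; apply: continuous_matrix => i j.
  have -> : (fun x => (- dyad x) i j) = fun x => - dyad x i j.
    by apply/funext => x; rewrite mxE.
  apply: continuous_opp => x.
  apply: (cvg_comp dyad (fun v : 'rV[F]_(n * n) => v i j)).
    exact: continuous_dyad.
  exact: continuous_entry.
- exact: compact_contact.
Qed.

Lemma signed_dyads_dependent k (s : 'I_k -> 'rV[F]_(n * n)) :
  (n * (n + 1) %/ 2 + 1 < k)%N -> (forall i, signed_dyads (s i)) ->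
  affinely_dependent k s.
Proof.
move=> nk Ss.
have sE : s = fun i => mxvec (vec_mx (s i)).
  by apply/funext => i; rewrite vec_mxK.
rewrite sE; apply: symmetric_affinely_dependent => // i.
case: (Ss i) => -[x _ <-]; rewrite /dyad ?linearN/= mxvecK ?linearN/=;
  by rewrite dyad_sym.
Qed.

(** A functional that is positive on the signed dyads is, up to sign and
    symmetrization, a form that is negative at all outer contact points and
    positive at all inner ones, which the hypothesis excludes.  So 0 is a convex
    combination of signed dyads; its positive weights, split by sign, give the
    two sides of the decomposition. *)
Lemma decomposition_of_forms :
  (forall A : 'M[F]_n, A^T = A ->
    exists y z : 'rV[F]_n, [/\ contact K R y, contact K r z &
      dotv (R^-1 *: y) ((R^-1 *: y) *m A) >=
      dotv (r^-1 *: z) ((r^-1 *: z) *m A)]) ->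
  exists (N M : nat) (y : 'I_N -> 'rV[F]_n) (z : 'I_M -> 'rV[F]_n)
    (lambda : 'I_N -> F) (mu : 'I_M -> F),
    contact_decomposition K R r y z lambda mu /\
    (N + M <= n * (n + 1) %/ 2 + 1)%N.
Proof.
move=> forms; rewrite addn1; set k := (n * (n + 1) %/ 2)%N.
have S0 : signed_dyads !=set0.
  have [|y [_ [yR _ _]]] := forms 0; first by rewrite trmx0.
  by exists (dyad y); left; exists y.
have dep (s : 'I_k.+2 -> 'rV[F]_(n * n)) : (forall i, signed_dyads (s i)) ->
    affinely_dependent k.+2 s.
  by apply: signed_dyads_dependent; rewrite addn1.
have [|[a aS]] := gordan_compact _ _ compact_signed_dyads S0 dep; last first.
  pose B : 'M[F]_n := - (vec_mx a + (vec_mx a)^T).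
  have BE x : dotv x (x *m B) = - (2 * dotv a (dyad x)).
    have e : dotv x (x *m vec_mx a) = dotv a (dyad x).
      by rewrite -dotv_dyad vec_mxK.
    rewrite mulmxN mulmxDr -scaleN1r !(dotvZr, dotvDr).
    have -> : dotv x (x *m (vec_mx a)^T) = dotv x (x *m vec_mx a).
      by rewrite dotvC [RHS]dotvE [LHS]dotvE trmx_mul mulmxA.
    by rewrite e; ring.
  have [|y [z [yR zr]]] := forms B.
    by rewrite linearN/= linearD/= trmxK addrC.
  rewrite -!scalemxAl !dotvZl !dotvZr !BE.
  have /aS ay : signed_dyads (dyad y) by left; exists y.
  have : signed_dyads (- dyad z) by right; exists z.
  move/aS; rewrite -scaleN1r dotvZr => az.
  have r1 : 0 < r^-1 * r^-1 by rewrite mulr_gt0// invr_gt0.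
  have R1 : 0 < R^-1 * R^-1 by rewrite mulr_gt0// invr_gt0.
  rewrite !mulrA leNgt => /negP; case.
  apply: (@lt_trans _ _ 0); first by rewrite pmulr_rlt0//; lra.
  by rewrite pmulr_rgt0//; lra.
move=> [w [s [w0 w1 Ss sum0]]].
(* The boolean records whether s i comes from an outer contact point. *)
pose good i (bx : bool * 'rV[F]_n) :=
  s i = (if bx.1 then dyad bx.2 else - dyad bx.2) /\
  contact K (if bx.1 then R else r) bx.2.
have /boolp.choice[f fP] : forall i, exists bx, good i bx.
  move=> i; rewrite /good; case: (Ss i) => -[x xc <-].
    by exists (true, x).
  by exists (false, x).
pose W := [pred i | 0 < w i]; pose B := [pred i | (f i).1].
pose P := [predI W & B]; pose Q := [predD W & B].
have drop0 (V : lmodType F) (C : pred 'I_k.+1) (g : 'I_k.+1 -> V) :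
    \sum_(i | C i) w i *: g i = \sum_(i | W i && C i) w i *: g i.
  rewrite big_mkcondl; apply: eq_bigr => i _ /=.
  have [//|wi] := ltP 0 (w i).
  have -> : w i = 0 by apply/eqP; rewrite eq_le wi w0.
  by rewrite scale0r.
have PQ (V : lmodType F) (g : 'I_k.+1 -> V) :
    \sum_i w i *: g i = \sum_(i in P) w i *: g i + \sum_(i in Q) w i *: g i.
  rewrite (bigID B)/= (drop0 V B) (drop0 V (predC B)); congr (_ + _).
  by apply: eq_bigl => i; rewrite !inE andbC.
have dyads : \sum_(i in P) w i *: dyad (f i).2 =
    \sum_(i in Q) w i *: dyad (f i).2.
  apply/eqP; rewrite -subr_eq0 [X in _ == X]sum0 PQ -sumrN; apply/eqP.
  congr (_ + _); apply: eq_bigr => i; rewrite !inE => /andP[].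
    by move=> _ /= b; have [-> _] := fP i; rewrite b.
  by move=> /negbTE /= b _; have [-> _] := fP i; rewrite b scalerN.
have Pc i : i \in P -> contact K R (f i).2.
  by rewrite !inE => /andP[_ /= b]; have [_] := fP i; rewrite b.
have Qc i : i \in Q -> contact K r (f i).2.
  by rewrite !inE => /andP[/negbTE /= b _]; have [_] := fP i; rewrite b.
pose p := \sum_(i in P) w i; pose q := \sum_(i in Q) w i.
have pq1 : p + q = 1.
  have scale1 i : w i *: (1 : F^o) = w i by exact: mulr1.
  have sum_scale1 (C : pred 'I_k.+1) :
      \sum_(i | C i) w i *: (1 : F^o) = \sum_(i | C i) w i.
    by apply: eq_bigr => i _; exact: scale1.
  have := PQ F^o (fun=> 1).
  rewrite (sum_scale1 predT) (sum_scale1 (mem P)) (sum_scale1 (mem Q)) w1.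
  by move=> ->.
have trace_dyads (C : pred 'I_k.+1) :
    dotv (mxvec 1%:M) (\sum_(i in C) w i *: dyad (f i).2) =
    \sum_(i in C) w i * dotv (f i).2 (f i).2.
  have dotv0r : dotv (mxvec 1%:M) (0 : 'rV[F]_(n * n)) = 0.
    by rewrite -(scale0r (mxvec 1%:M)) dotvZr mul0r.
  rewrite (big_morph _ (dotvDr (mxvec 1%:M)) dotv0r); apply: eq_bigr => i _.
  by rewrite dotvZr dotv_dyad mulmx1.
have pq : p * R ^+ 2 = q * r ^+ 2.
  have := congr1 (dotv (mxvec 1%:M)) dyads; rewrite !trace_dyads.
  rewrite /p /q !mulr_suml.
  under eq_bigr => i Pi do rewrite (contact_sqnorm _ _ hR (Pc i Pi)).
  by under [X in _ = X -> _]eq_bigr => i Qi do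
    rewrite (contact_sqnorm _ _ hr (Qc i Qi)).
have R2 : R ^+ 2 != 0 by rewrite gt_eqF ?exprn_gt0.
have r2 : r ^+ 2 != 0 by rewrite gt_eqF ?exprn_gt0.
(* If one side were empty, the trace identity would make both weights 0. *)
have [p0 q0] : p != 0 /\ q != 0.
  split; apply/eqP => e; move/eqP: pq; rewrite e mul0r.
    rewrite eq_sym mulf_eq0 (negbTE r2) orbF => /eqP q0.
    by move/eqP: pq1; rewrite e q0 addr0 eq_sym oner_eq0.
  rewrite mulf_eq0 (negbTE R2) orbF => /eqP p0.
  by move/eqP: pq1; rewrite e p0 addr0 eq_sym oner_eq0.
exists #|P|, #|Q|, (fun i => (f (enum_val i)).2), (fun i => (f (enum_val i)).2).
exists (fun i => w (enum_val i)), (fun i => w (enum_val i)); split; last first.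
  by rewrite cardID (leq_trans (max_card _))// card_ord.
split.
- split; rewrite lt0n; apply/negP => /eqP card0.
    by move/eqP: p0; apply; rewrite /p big_pred0//; exact: card0_eq.
  by move/eqP: q0; apply; rewrite /q big_pred0//; exact: card0_eq.
- by split=> i; [apply: Pc|apply: Qc]; exact: enum_valP.
- split=> i; have := enum_valP i; rewrite !inE => /andP[]//.
- move=> x; under eq_bigr do rewrite dotv_scale_dyad.
  under [RHS]eq_bigr do rewrite dotv_scale_dyad.
  rewrite -!mulmx_sumr.
  rewrite -(big_enum_val (A := P) (fun i => w i *: ((f i).2^T *m (f i).2))).
  rewrite -(big_enum_val (A := Q) (fun i => w i *: ((f i).2^T *m (f i).2))).
  congr (x *m _); apply: (can_inj mxvecK); rewrite !linear_sum/=.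
  under eq_bigr do rewrite linearZ.
  by under [RHS]eq_bigr do rewrite linearZ.
Qed.

End Necessity.

(** * The characterization *)

(* For symmetric A, the row vector y *m A is the transpose of A y. *)
Theorem theorem1p2 (F : realType) (n : nat) (K : set 'rV[F]_n) (R r : F)
    (hK : convex_body K) (hsym : origin_symmetric K)
    (hr : 0 < r) (hrR : r <= R)
    (hin : dilate r (unit_ball F n) `<=` K)
    (hout : K `<=` dilate R (unit_ball F n)) :
  [/\ dBM K (unit_ball F n) = R / r <->
      (forall A : 'M[F]_n, A^T = A ->
         exists y z : 'rV[F]_n,
           [/\ contact K R y, contact K r z &
               dotv (R^-1 *: y) ((R^-1 *: y) *m A) >=
               dotv (r^-1 *: z) ((r^-1 *: z) *m A)]),
      dBM K (unit_ball F n) = R / r <->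
      (exists (N M : nat) (y : 'I_N -> 'rV[F]_n) (z : 'I_M -> 'rV[F]_n)
              (lambda : 'I_N -> F) (mu : 'I_M -> F),
         contact_decomposition K R r y z lambda mu),
      (forall (N M : nat) (y : 'I_N -> 'rV[F]_n) (z : 'I_M -> 'rV[F]_n)
              (lambda : 'I_N -> F) (mu : 'I_M -> F),
         contact_decomposition K R r y z lambda mu ->
         R ^+ 2 * \sum_(i < N) lambda i = r ^+ 2 * \sum_(j < M) mu j) &
      (dBM K (unit_ball F n) = R / r ->
       exists (N M : nat) (y : 'I_N -> 'rV[F]_n) (z : 'I_M -> 'rV[F]_n)
              (lambda : 'I_N -> F) (mu : 'I_M -> F),
         contact_decomposition K R r y z lambda mu /\
         (N + M <= n * (n + 1) %/ 2 + 1)%N)].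
Proof.
have hR : 0 < R by exact: lt_le_trans hr hrR.
have [cK _ _] := hK.
have dBM_forms : dBM K (unit_ball F n) = R / r ->
    forall A : 'M[F]_n, A^T = A -> exists y z : 'rV[F]_n,
      [/\ contact K R y, contact K r z &
        dotv (R^-1 *: y) ((R^-1 *: y) *m A) >=
        dotv (r^-1 *: z) ((r^-1 *: z) *m A)].
  move=> /(dBM_eq_ratio hK hsym hr hR hin hout) bound A _.
  apply: contrapT => noyz.
  have [|B [Bout Bin]] := separating_form cK hr hR A.
    move=> y z yR zr; rewrite ltNge; apply/negP => ge; apply: noyz.
    exists y, z; split=> //.
    rewrite -!scalemxAl !dotvZl !dotvZr !mulrA -!expr2 !exprVn.
    by rewrite ![_^-1 * _]mulrC.
  have [rho [rho0 rho_lt rhoK]] :=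
    sandwich_perturb cK hr hR hin hout B Bout Bin.
  by have := bound rho rho0 rhoK; rewrite leNgt rho_lt.
have dec_dBM N M (y : 'I_N -> 'rV[F]_n) (z : 'I_M -> 'rV[F]_n) lambda mu :
    contact_decomposition K R r y z lambda mu ->
    dBM K (unit_ball F n) = R / r.
  move=> dec; apply/(dBM_eq_ratio hK hsym hr hR hin hout) => rho rho0.
  exact: (sandwich_lower_bound cK hr hR dec).
have forms_dec := decomposition_of_forms cK hr hR.
split.
- split; first exact: dBM_forms.
  by move=> /forms_dec[N [M [y [z [lambda [mu [/dec_dBM]]]]]]].
- split; last by move=> [N [M [y [z [lambda [mu /dec_dBM]]]]]].
  move=> /dBM_forms/forms_dec[N [M [y [z [lambda [mu [dec _]]]]]]].
  by exists N, M, y, z, lambda, mu.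
- by move=> N M y z lambda mu; exact: decomposition_trace.
- by move=> /dBM_forms/forms_dec.
Qed.
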